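(* Let $G$ be a finite abelian group and let $D\subseteq G$ be a nonempty $(v,k,\lambda)$-difference set in $G$ with $\lambda\ge 1$. Then there is a set of $(k^2-k+\lambda)/\lambda$ equiangular lines in $\mathbb{C}^k$.
   Context: A subset $D$ of a group $G$ is a $(v,k,\lambda)$-difference set if $|G|=v$, $|D|=k$, and every non-identity element of $G$ can be written as $gh^{-1}$ with $(g,h)\in D\times D$ in exactly $\lambda$ ways. A set of $N$ equiangular lines in $\mathbb{C}^k$ is a set of $N$ unit vectors, spanning pairwise distinct one-dimensional subspaces, such that $|x^*y|^2$ is the same constant for all pairs of distinct vectors $x,y$ in the set. *)

(* Defs.v *)
From HB Require Import structures.
From mathcomp Require Import all_boot all_order all_algebra all_fingroup.
From mathcomp Require Import finmap complex reals.

Set Implicit Arguments.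
Unset Strict Implicit.
Unset Printing Implicit Defensive.

Import Order.TTheory GRing.Theory Num.Theory.

Definition difference_set (gT : finGroupType) (G : {group gT}) (D : {set gT})
    (v k l : nat) : Prop :=
  [/\ D \subset G, #|G| = v, #|D| = k &
      forall x : gT, x \in G -> x != 1%g ->
        #|[set p in setX D D | (p.1 * p.2^-1)%g == x]| = l].

Local Open Scope ring_scope.
Local Open Scope sesquilinear_scope.

Section Equiangular.
Variables (R : realType) (k : nat).

(* The product x^* y; as R is a complete archimedean field, R[i] is the field
   of complex numbers. *)
Definition cdot (x y : 'cV[R[i]]_k) : R[i] :=
  (x ^t* *m y) 0 0.

(* The norm on R[i] takes its values in R[i], so the common value c of
   |x^* y|^2 is automatically a nonnegative real number, and it may be 0. *)
Definition equiangular_lines (S : {fset 'cV[R[i]]_k}) : Prop :=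
  [/\ forall x, x \in S -> cdot x x = 1,
      forall x y, x \in S -> y \in S -> x != y -> <[x]>%VS != <[y]>%VS &
      exists c : R[i], forall x y, x \in S -> y \in S -> x != y ->
        `|cdot x y| ^+ 2 = c].

End Equiangular.

(* Main.v *)
(* For a nontrivial character [f] of [G], counting the quotients [a * b^-1] with
   [a, b] in [D] gives [|\sum_(d in D) f d|^2 = k + l * \sum_(x != 1) f x = k - l].
   The [v] characters of [G], restricted to [D] and divided by [sqrt k], are unit
   vectors whose inner products are such sums over [k], hence have squared modulus
   [(k - l) / k^2 < 1]; counting all pairs gives [v * l = k^2 - k + l]. *)
Require Import Defs.
From HB Require Import structures.
From mathcomp Require Import all_boot all_order all_algebra all_fingroup.
From mathcomp Require Import finmap complex reals.
From mathcomp Require Import center pgroup cyclic mxrepresentation.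

Set Implicit Arguments.
Unset Strict Implicit.
Unset Printing Implicit Defensive.

Import Order.TTheory GRing.Theory Num.Theory.
Local Open Scope ring_scope.

Definition linear_character (C : numClosedFieldType) (gT : finGroupType)
    (G : {set gT}) (f : gT -> C) : Prop :=
  f 1%g = 1 /\ {in G &, {morph f : x y / (x * y)%g >-> x * y}}.

(** Irreducible representations of an abelian group over an algebraically closed field have degree
    1, and [irr_mode] is the scalar by which an element acts. In characteristic 0 there are as many
    of them as conjugacy classes, that is, elements. *)
Lemma abelian_linear_characters (C : numClosedFieldType) (gT : finGroupType)
    (G : {group gT}) :
  abelian G ->
  exists (I : finType) (chi : I -> gT -> C),
    [/\ #|I| = #|G|, forall i, linear_character G (chi i) &
        forall i j, {in G, chi i =1 chi j} -> i = j].
Proof.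
move=> abG.
have splitG : group_splitting_field C G by exact: group_closure_closed_field.
have C'G : pgroup [pchar C]^' G.
  by apply/pgroupP => p _ _; rewrite inE /= pchar_num.
pose sG : irrType C G := DecSocleType (regular_repr C G).
exists sG, (@irr_mode C gT G sG); split=> [|i|i j eq_ij].
- by rewrite card_irr_pchar //; apply/eqP; rewrite -card_classes_abelian.
- split; first exact: irr_mode1.
  by move=> x y Gx Gy; rewrite irr_modeM ?(center_idP _).
have scal (W : sG) x : x \in G -> irr_repr W x = (irr_mode W x)%:M.
  by move=> Gx; apply: irr_center_scalar; rewrite ?(center_idP _).
rewrite -(irr_reprK_pchar C'G i) -(irr_reprK_pchar C'G j).
have degI W : irr_degree W = 1%N := irr_degree_abelian splitG abG (W : sG).
(* Generalizing the representations lets their degrees be rewritten to 1; both then act by the same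
   scalars, so the identity matrix is a similarity. *)
move: (irr_repr i) (irr_repr j) (scal i) (scal j).
rewrite !degI => ri rj si sj; apply: irr_comp_rsim_pchar => //.
exists 1%:M; rewrite ?row_free_unit ?unitmx1 // => x Gx.
by rewrite mulmx1 mul1mx si // sj // eq_ij.
Qed.

Section LinearCharacter.
Variables (C : numClosedFieldType) (gT : finGroupType) (G : {group gT}).
Variable f : gT -> C.
Hypothesis char_f : linear_character G f.

Lemma linear_character_norm x : x \in G -> `|f x| = 1.
Proof.
move=> Gx; have [f1 fM] := char_f.
have fX n : f (x ^+ n)%g = f x ^+ n.
  by elim: n => // n IHn; rewrite expgS fM ?groupX // IHn exprS.
(* [f x] is a root of unity, since [x ^+ #|G|] is trivial. *)
apply/eqP; rewrite -(@pexpr_eq1 _ _ #|G|) ?cardG_gt0 // -normrX -fX.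
by rewrite expg_cardG // f1 normr1.
Qed.

Lemma linear_character_conj x : x \in G -> f x^-1%g = (f x)^*.
Proof.
move=> Gx; have [f1 fM] := char_f; have nfx := linear_character_norm Gx.
have nz : f x != 0 by rewrite -normr_eq0 nfx oner_eq0.
apply: (mulfI nz); rewrite -fM ?groupV // mulgV f1.
by rewrite -normCK nfx expr1n.
Qed.

Lemma linear_character_sum : ~ {in G, f =1 fun=> 1} -> \sum_(x in G) f x = 0.
Proof.
move=> ntf; have [f1 fM] := char_f.
have [/forall_inP f_1|/forall_inPn[y Gy fy1]] :=
    boolP [forall x in G, f x == 1].
  by case: ntf => x /f_1/eqP.
(* Translation by [y] permutes [G], so multiplying the sum by [f y], which is not 1, leaves it
   unchanged. *)
apply: (@mulfI _ (f y - 1)); first by rewrite subr_eq0.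
rewrite mulr0 mulrBl mul1r mulr_sumr; apply/eqP; rewrite subr_eq0; apply/eqP.
rewrite [RHS](reindex_inj (mulgI y)); apply: eq_big => x.
  by rewrite groupMl.
by move=> Gx; rewrite fM.
Qed.

End LinearCharacter.

Lemma linear_character_conjM (C : numClosedFieldType) (gT : finGroupType)
    (G : {set gT}) (f g : gT -> C) :
  linear_character G f -> linear_character G g ->
  linear_character G (fun x => (f x)^* * g x).
Proof.
move=> [f1 fM] [g1 gM]; split=> [|x y Gx Gy].
  by rewrite f1 g1 rmorph1 mulr1.
by rewrite fM // gM // rmorphM mulrACA.
Qed.

Section DifferenceSet.
Variables (gT : finGroupType) (G : {group gT}) (D : {set gT}) (v k l : nat).
Hypothesis dsD : difference_set G D v k l.

(** Pairs are grouped by their quotient. The generality in [F] covers both the counting of pairs,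
    with [F] constant, and character sums. *)
Lemma difference_set_sum_quotients (V : zmodType) (F : gT -> V) :
  \sum_(a in D) \sum_(b in D) F (a * b^-1)%g
    = F 1%g *+ k + (\sum_(x in G | x != 1%g) F x) *+ l.
Proof.
have [/subsetP sDG _ cardD dsDl] := dsD.
rewrite pair_big /=.
rewrite (partition_big (fun p => p.1 * p.2^-1)%g (mem G)) /=; last first.
  by case=> a b /= /andP[/sDG Ga /sDG Gb]; rewrite groupM ?groupV.
have countE x : \sum_(p | ((p.1 \in D) && (p.2 \in D)) && (p.1 * p.2^-1 == x)%g)
    F (p.1 * p.2^-1)%g = F x *+ #|[set p in setX D D | (p.1 * p.2^-1)%g == x]|.
  rewrite -sumr_const; apply: eq_big => [p|p /andP[_ /eqP-> //]].
  by rewrite !inE.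
rewrite (eq_bigr _ (fun x _ => countE x)) (bigD1 1%g) ?group1 //=; congr (_ + _).
  (* The pairs with quotient 1 form the diagonal of [D]. *)
  rewrite -cardD; congr (_ *+ _).
  rewrite -(card_imset (mem D) (f := fun a => (a, a))); last by move=> a b [].
  apply: eq_card => -[a b]; rewrite !inE /= -eq_mulgV1.
  apply/andP/imsetP => [[/andP[Da _] /eqP<-]|[c Dc [-> ->]]]; first by exists a.
  by rewrite Dc.
by rewrite -sumrMnl; apply: eq_bigr => x /andP[Gx x1]; rewrite dsDl.
Qed.

Lemma difference_set_card : (v * l + k = k ^ 2 + l)%N.
Proof.
have [_ cardG cardD _] := dsD.
have sum1 : \sum_(x in G | x != 1%g) 1%:Z = v%:R - 1.
  by rewrite -cardG -sumr_const [in RHS](bigD1 1%g) //= addrAC subrr add0r.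
have := difference_set_sum_quotients (fun=> 1%:Z).
rewrite sum1 !sumr_const cardD -!mulrnA mulnn mulrnBl -mulrnA => eqZ.
apply/eqP; rewrite -(eqr_nat int) !natrD eqZ.
by rewrite addrA subrK addrC.
Qed.

Lemma difference_set_character_sum (C : numClosedFieldType) (f : gT -> C) :
  linear_character G f -> ~ {in G, f =1 fun=> 1} ->
  `|\sum_(d in D) f d| ^+ 2 = k%:R - l%:R.
Proof.
move=> char_f ntf; have [/subsetP sDG _ _ _] := dsD; have [f1 fM] := char_f.
have := linear_character_sum char_f ntf; rewrite (bigD1 1%g) //= f1 => /eqP.
rewrite addrC addr_eq0 => /eqP sumf.
(* Conjugating [f b] gives [f b^-1], so the squared modulus expands into a sum over quotients. *)
transitivity (\sum_(a in D) \sum_(b in D) f (a * b^-1)%g).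
  rewrite normCK rmorph_sum mulr_suml; apply: eq_bigr => a Da.
  rewrite mulr_sumr; apply: eq_bigr => b Db.
  by rewrite fM ?groupV ?sDG // (linear_character_conj char_f) ?sDG.
by rewrite difference_set_sum_quotients f1 sumf mulNrn.
Qed.

End DifferenceSet.

Lemma cdotZr (R : realType) (k : nat) (a : R[i]) (x y : 'cV[R[i]]_k) :
  cdot x (a *: y) = a * cdot x y.
Proof. by rewrite /cdot -scalemxAr mxE. Qed.

(** Unit vectors on one line differ by a scalar of modulus 1. This later separates the lines, whose
    inner products have smaller modulus. *)
Lemma cdot_colinear (R : realType) (k : nat) (x y : 'cV[R[i]]_k) :
  cdot x x = 1 -> cdot y y = 1 -> <[x]>%VS = <[y]>%VS -> `|cdot x y| = 1.
Proof.
move=> x1 y1 eqxy; have : y \in <[x]>%VS by rewrite eqxy memv_line.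
case/vlineP=> a def_y; rewrite def_y cdotZr x1 mulr1.
have /eqP : `|a| ^+ 2 = 1.
  rewrite normCK -y1 def_y cdotZr; congr (_ * _).
  by rewrite /cdot linearZ /= map_mxZ -scalemxAl mxE -/(cdot x x) x1 mulr1.
by rewrite pexpr_eq1 // => /eqP.
Qed.

Theorem corollary4p1p2 (R : realType) (gT : finGroupType) (G : {group gT})
    (D : {set gT}) (v k l : nat)
    (abG : abelian G) (D_neq0 : D != set0)
    (dsD : difference_set G D v k l) (l_ge1 : (1 <= l)%N) :
  exists2 N : nat,
    N%:R = (k%:R ^+ 2 - k%:R + l%:R) / l%:R :> rat &
    exists2 S : {fset 'cV[R[i]]_k}, #|` S|%fset = N & equiangular_lines S.
Proof.
exists v.
  have l_neq0 : l%:R != 0 :> rat by rewrite pnatr_eq0 -lt0n.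
  apply: (canRL (mulfK l_neq0)); rewrite -natrM -natrX addrAC -natrD.
  by rewrite -(difference_set_card dsD) natrD addrK.
have [/subsetP sDG cardG cardD _] := dsD.
have k_gt0 : (0 < k)%N by rewrite -cardD card_gt0.
(* With [k] equal to [#|D|] by definition, [enum_val] indexes coordinates by the elements of [D]. *)
subst k; set k := #|D| in k_gt0 dsD *.
have [I [chi [cardI char_chi chi_inj]]] := abelian_linear_characters R[i] abG.
pose x i : 'cV[R[i]]_k := \col_d (chi i (enum_val d) / sqrtC k%:R).
have cdot_x i j : cdot (x i) (x j) = (\sum_(d in D) (chi i d)^* * chi j d) / k%:R.
  rewrite /cdot mxE [in RHS]big_enum_val mulr_suml; apply: eq_bigr => d _.
  rewrite !mxE rmorphM fmorphV mulrACA; congr (_ * _).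
  by rewrite /= geC0_conj ?sqrtC_ge0 ?ler0n // -invfM -expr2 sqrtCK.
have k_neq0 : k%:R != 0 :> R[i] by rewrite pnatr_eq0 -lt0n.
have x_unit i : cdot (x i) (x i) = 1.
  rewrite cdot_x (eq_bigr (fun=> 1)) ?sumr_const ?divff // => d Dd.
  by rewrite mulrC -normCK (linear_character_norm (char_chi i)) ?sDG // expr1n.
have x_angle i j : i != j -> `|cdot (x i) (x j)| ^+ 2 = (k%:R - l%:R) / k%:R ^+ 2.
  move=> neq_ij; rewrite cdot_x normf_div expr_div_n normr_nat; congr (_ / _).
  apply: (difference_set_character_sum dsD).
    exact: linear_character_conjM.
  (* If the conjugate of [chi i] times [chi j] is trivial, multiplying by [chi i] gives
     [chi i = chi j] on [G]. *)
  move=> triv; case/eqP: neq_ij; apply: chi_inj => g Gg.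
  have ng := linear_character_norm (char_chi i) Gg.
  by rewrite -[LHS]mulr1 -(triv g Gg) mulrA -normCK ng expr1n mul1r.
have x_line i j : i != j -> <[x i]>%VS != <[x j]>%VS.
  move=> neq_ij; apply/eqP => /(cdot_colinear (x_unit i) (x_unit j)) norm1.
  (* Equal lines would force [k = k ^ 2 + l], impossible as [k <= k ^ 2] and [1 <= l]. *)
  have := x_angle i j neq_ij; rewrite norm1 expr1n => /esym/divr1_eq/eqP.
  rewrite subr_eq -natrX -natrD eqr_nat ltn_eqF //.
  by rewrite -addn1 leq_add // -mulnn leq_pmulr.
have x_inj : injective x.
  move=> i j eq_ij; apply/eqP; apply/negPn/negP => /x_line.
  by rewrite eq_ij eqxx.
exists [fset x i | i in I]%fset.
  by rewrite card_imfset //= -cardE cardI.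
split.
- by move=> _ /imfsetP[i _ ->].
- move=> _ _ /imfsetP[i _ ->] /imfsetP[j _ ->]; rewrite (inj_eq x_inj).
  exact: x_line.
- exists ((k%:R - l%:R) / k%:R ^+ 2).
  move=> _ _ /imfsetP[i _ ->] /imfsetP[j _ ->]; rewrite (inj_eq x_inj).
  exact: x_angle.
Qed.
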